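(* Let $\mu = 3.579$. For any BMS channel $W$ with capacity $I(W)\in(0,1)$ there exist constants $P_{\rm e}>0$ and $\alpha>0$, depending only on $I(W)$, such that for every block-length $N=2^n$ ($n\in\mathbb{N}$) and every rate $R$ with $NR\in\{0,1,\dots,N\}$, the condition $$\sum_{i\in\mathcal{I}_{N,R}} E\bigl(W_N^{(i)}\bigr)\le P_{\rm e}$$ implies $$R < I(W)-\frac{\alpha}{N^{1/\mu}} .$$
   Context: All logarithms are base $2$; $\mathbb{N}=\{0,1,2,\dots\}$. A BMS channel $W:\{0,1\}\to\mathcal{Y}$ is a binary-input memoryless output-symmetric channel with discrete output alphabet $\mathcal{Y}$ and transition probabilities $W(y\mid x)$ (output-symmetric: there is an involution $\pi$ of $\mathcal{Y}$ with $W(y\mid 1)=W(\pi(y)\mid 0)$ for all $y$). Its entropy is $H(W)=\sum_{y}W(y\mid 1)\log\frac{W(y\mid 1)+W(y\mid 0)}{W(y\mid 1)}$ and its capacity is $I(W)=1-H(W)$. Its error probability is $E(W)=\sum_{y}W(y\mid 1)\bigl(\mathbf{1}_{\{W(y\mid 0)>W(y\mid 1)\}}+\tfrac12\mathbf{1}_{\{W(y\mid 0)=W(y\mid 1)\}}\bigr)$. Channel transform $W\mapsto(W^0,W^1)$: $W^0:\{0,1\}\to\mathcal{Y}^2$ and $W^1:\{0,1\}\to\mathcal{Y}^2\times\{0,1\}$ are the BMS channels $W^0(y_1,y_2\mid x_1)=\sum_{x_2\in\{0,1\}}\tfrac12 W(y_1\mid x_1\oplus x_2)W(y_2\mid x_2)$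 and $W^1(y_1,y_2,x_1\mid x_2)=\tfrac12 W(y_1\mid x_1\oplus x_2)W(y_2\mid x_2)$. For $N=2^n$ and $0\le i\le N-1$ with binary expansion $b_1b_2\cdots b_n$ ($b_1$ the most significant bit), $W_N^{(i)}=(((W^{b_1})^{b_2})^{\cdots})^{b_n}$. The set of good indices $\mathcal{I}_{N,R}\subseteq\{0,\dots,N-1\}$ is the set of the $N\cdot R$ indices $i$ whose channels $W_N^{(i)}$ have the smallest error probability $E(W_N^{(i)})$ (ties broken arbitrarily). *)

(* Defs.v *)
From HB Require Import structures.
From mathcomp Require Import all_boot all_order all_algebra.
From mathcomp Require Import finmap ring lra.
From mathcomp Require Import mathcomp_extra boolp classical_sets functions.
From mathcomp Require Import cardinality fsbigop reals ereal esum exp.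

Set Implicit Arguments.
Unset Strict Implicit.
Unset Printing Implicit Defensive.

Import Order.TTheory GRing.Theory Num.Theory.

Local Open Scope classical_set_scope.
Local Open Scope ring_scope.

(* The input alphabet {0,1} is [bool], with x1 (+) x2 the exclusive or.  The
   output alphabet is any finite or countably infinite set, so sums over it
   are unconditional sums of nonnegative extended reals. *)
Record bms (R : realType) := Bms {
  output : countType;
  prob : bool -> output -> R;
  prob_ge0 : forall x y, 0 <= prob x y;
  prob_sum1 : forall x, (\esum_(y in [set: output]) (prob x y)%:E = 1)%E;
  prob_sym : exists2 s : output -> output,
    involutive s & forall y, prob true y = prob false (s y) }.

Arguments prob {R} W x y : rename.
Arguments prob_ge0 {R} W x y : rename.
Arguments prob_sum1 {R} W x : rename.
Arguments prob_sym {R} W : rename.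

Definition log2 (R : realType) (x : R) : R := ln x / ln 2.

Section ChannelQuantities.
Variables (R : realType) (W : bms R).

(* For prob W true y = 0 the term is 0, which is the usual convention. *)
Definition entropy_term (y : output W) : R :=
  prob W true y * log2 ((prob W true y + prob W false y) / prob W true y).

Definition entropy : R :=
  fine (\esum_(y in [set: output W]) (entropy_term y)%:E)%E.

Definition capacity : R := 1 - entropy.

Definition error_term (y : output W) : R :=
  prob W true y * ((prob W true y < prob W false y)%R%:R
                   + 2^-1 * (prob W false y == prob W true y)%:R).

Definition error_prob : R :=
  fine (\esum_(y in [set: output W]) (error_term y)%:E)%E.

(* All terms are nonnegative and both sums are finite, so that [fine] returns
   their actual values. *)
Lemma entropy_term_ge0 y : 0 <= entropy_term y.
Proof.
rewrite /entropy_term /log2.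
have [->|p0] := eqVneq (prob W true y) 0; first by rewrite mul0r.
have p_gt0 : 0 < prob W true y by rewrite lt_def p0 prob_ge0.
rewrite mulr_ge0 ?prob_ge0 // divr_ge0 // ln_ge0 ?ler1n //.
by rewrite ler_pdivlMr // mul1r lerDl prob_ge0.
Qed.

Lemma error_term_ge0 y : 0 <= error_term y.
Proof. by rewrite mulr_ge0 ?prob_ge0 // addr_ge0 ?mulr_ge0 ?invr_ge0. Qed.

Lemma entropy_fin_num :
  (\esum_(y in [set: output W]) (entropy_term y)%:E)%E \is a fin_num.
Proof.
have l2 : 0 < ln 2 :> R by rewrite ln_gt0 // ltr1n.
suff le_sum : (\esum_(y in [set: output W]) (entropy_term y)%:E <=
          (ln 2)^-1%:E)%E.
  rewrite ge0_fin_numE; first exact: le_lt_trans le_sum (ltry _).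
  by apply: esum_ge0 => y _; rewrite lee_fin entropy_term_ge0.
apply: ge_ereal_sup => _ [A [finA _] <-].
rewrite fsbig_finite //=.
have pA : (\sum_(y <- fset_set A) (prob W false y)%:E <= 1)%E.
  rewrite -(prob_sum1 W false); apply: esum_ge; exists A => //.
  by rewrite fsbig_finite.
have termP y : entropy_term y <= (ln 2)^-1 * prob W false y.
  rewrite /entropy_term /log2.
  have [->|p0] := eqVneq (prob W true y) 0.
    by rewrite mul0r mulr_ge0 ?prob_ge0 ?invr_ge0 ?ltW.
  have p_gt0 : 0 < prob W true y by rewrite lt_def p0 prob_ge0.
  rewrite mulrA mulrC ler_pM2l ?invr_gt0 // mulrC -ler_pdivlMr //.
  rewrite mulrDl divff // le_ln1Dx // (lt_le_trans (ltrN10 R)) //.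
  by rewrite divr_ge0 ?prob_ge0.
rewrite sumEFin lee_fin.
have {}pA : \sum_(y <- fset_set A) prob W false y <= 1.
  by rewrite -lee_fin -sumEFin.
apply: (@le_trans _ _ (\sum_(y <- fset_set A) (ln 2)^-1 * prob W false y)).
  exact: ler_sum.
by rewrite -mulr_sumr ler_piMr // invr_ge0 ltW.
Qed.

Lemma error_fin_num :
  (\esum_(y in [set: output W]) (error_term y)%:E)%E \is a fin_num.
Proof.
rewrite ge0_fin_numE; last first.
  by apply: esum_ge0 => y _; rewrite lee_fin error_term_ge0.
apply: (@le_lt_trans _ _ 1%E); last exact: ltry.
rewrite -(prob_sum1 W true); apply: le_esum => y _.
rewrite lee_fin ler_piMr ?prob_ge0 //.
by case: ltgtP => _; rewrite ?mulr0 ?mulr1 ?addr0 ?add0r //; lra.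
Qed.

End ChannelQuantities.

Section Transform.
Variables (R : realType) (W : bms R).
Let Y := output W.

Definition prob0 (x1 : bool) (y : Y * Y) : R :=
  \sum_(x2 : bool) 2^-1 * prob W (x1 (+) x2) y.1 * prob W x2 y.2.

Definition prob1 (x2 : bool) (z : Y * Y * bool) : R :=
  2^-1 * prob W (z.2 (+) x2) z.1.1 * prob W x2 z.1.2.

Lemma prob0_ge0 x y : 0 <= prob0 x y.
Proof. by apply: sumr_ge0 => x2 _; rewrite !mulr_ge0 ?prob_ge0 ?invr_ge0. Qed.

Lemma prob1_ge0 x z : 0 <= prob1 x z.
Proof. by rewrite !mulr_ge0 ?prob_ge0 ?invr_ge0. Qed.

Lemma esumZl (T : choiceType) (c : R) (f : T -> R) : 0 <= c ->
  (\esum_(t in [set: T]) (c * f t)%:E =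
   c%:E * \esum_(t in [set: T]) (f t)%:E)%E.
Proof.
move=> c0; rewrite /esum -ereal_supZl //; last first.
  by apply/set0P; exists 0%E; exists set0; rewrite ?fsbig_set0 //; split.
have EZ A : finite_set A ->
    (\sum_(t \in A) (c * f t)%:E = c%:E * \sum_(t \in A) (f t)%:E)%E.
  by move=> fA; rewrite !fsbig_finite //= !sumEFin -EFinM mulr_sumr.
congr ereal_sup; apply/seteqP; split => z /=.
  by move=> [A [fA sA] <-]; exists (\sum_(t \in A) (f t)%:E)%E;
    [exists A | rewrite EZ].
by move=> [w [A [fA sA] <-] <-]; exists A; rewrite // EZ.
Qed.

Lemma esum_prod (a b : bool) :
  (\esum_(y in [set: Y * Y]) (2^-1 * prob W a y.1 * prob W b y.2)%:E
   = (2^-1)%:E)%E.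
Proof.
have := @esum_esum R Y Y setT (fun _ => setT)
  (fun y1 y2 => (2^-1 * prob W a y1 * prob W b y2)%:E).
have -> : [set: Y] `*`` (fun=> [set: Y]) = [set: Y * Y].
  by apply/seteqP; split.
move=> <-; last by move=> *; rewrite lee_fin !mulr_ge0 ?prob_ge0 ?invr_ge0.
rewrite (eq_esum (b := fun y1 => (2^-1 * prob W a y1)%:E)).
  by rewrite esumZl ?invr_ge0 // prob_sum1 mule1.
move=> y1 _; rewrite esumZl ?prob_sum1 ?mule1 //.
by rewrite mulr_ge0 ?invr_ge0 ?prob_ge0.
Qed.

Lemma prob0_sum1 x : (\esum_(y in [set: Y * Y]) (prob0 x y)%:E = 1)%E.
Proof.
rewrite (eq_esum (b := fun y => \sum_(x2 : bool)
  (2^-1 * prob W (x (+) x2) y.1 * prob W x2 y.2)%:E)%E); last first.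
  by move=> y _; rewrite sumEFin.
rewrite esum_sum; last first.
  by move=> *; rewrite lee_fin !mulr_ge0 ?prob_ge0 ?invr_ge0.
by rewrite big_bool /= !esum_prod -EFinD; congr EFin; lra.
Qed.

Lemma prob1_sum1 x : (\esum_(z in [set: Y * Y * bool]) (prob1 x z)%:E = 1)%E.
Proof.
have := @esum_esum R (Y * Y)%type bool setT (fun _ => setT)
  (fun y u => (prob1 x (y, u))%:E).
have -> : [set: Y * Y] `*`` (fun=> [set: bool]) = [set: Y * Y * bool].
  by apply/seteqP; split.
move=> H; rewrite (eq_esum (b := fun k => (prob1 x (k.1, k.2))%:E)); last first.
  by case.
rewrite -H; last by move=> *; rewrite lee_fin prob1_ge0.
rewrite (eq_esum (b := fun y => (2^-1 * prob W x y.1 * prob W x y.2)%:E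
   + (2^-1 * prob W (~~ x) y.1 * prob W x y.2)%:E)%E).
  rewrite esumD; try by move=> *; rewrite lee_fin !mulr_ge0 ?prob_ge0 ?invr_ge0.
  by rewrite !esum_prod -EFinD; congr EFin; lra.
move=> y _; rewrite esum_fset; last 2 first.
- exact: finite_finset.
- by move=> *; rewrite lee_fin prob1_ge0.
rewrite (fsbigE [:: false; true]) //=; last by move=> [] _; rewrite !inE.
by rewrite !big_cons big_nil !in_setT adde0 /prob1 /=; case: (x).
Qed.

Lemma prob0_sym : exists2 s : Y * Y -> Y * Y,
  involutive s & forall y, prob0 true y = prob0 false (s y).
Proof.
have [s sK sW] := prob_sym W.
exists (fun y => (s y.1, y.2)) => [[y1 y2] /=|[y1 y2]]; first by rewrite sK.
by rewrite /prob0 !big_bool /= -(sW y1) (sW (s y1)) sK.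
Qed.

Lemma prob1_sym : exists2 s : Y * Y * bool -> Y * Y * bool,
  involutive s & forall z, prob1 true z = prob1 false (s z).
Proof.
have [s sK sW] := prob_sym W.
exists (fun z => (s z.1.1, s z.1.2, z.2)) => [[[y1 y2] u] /=|[[y1 y2] u]].
  by rewrite !sK.
by rewrite /prob1 /= -(sW y2); case: u; rewrite /= -?(sW y1) ?(sW (s y1)) ?sK.
Qed.

Definition transform0 : bms R := Bms prob0_ge0 prob0_sum1 prob0_sym.
Definition transform1 : bms R := Bms prob1_ge0 prob1_sum1 prob1_sym.

Definition transform (b : bool) : bms R := if b then transform1 else transform0.

End Transform.

(* b_1 ... b_n, most significant bit first. *)
Definition bits (n i : nat) : seq bool :=
  [seq odd (i %/ 2 ^ (n - j)) | j <- iota 1 n].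

(* W_N^(i) for N = 2 ^ n *)
Definition subchannel (R : realType) (W : bms R) (n i : nat) : bms R :=
  foldl (@transform R) W (bits n i).

(* G is one of the possible sets of good indices at rate r, for N = 2 ^ n; it
   is not unique when error probabilities coincide. *)
Definition good_indices (R : realType) (W : bms R) (n : nat) (r : R)
    (G : {set 'I_(2 ^ n)}) : Prop :=
  #|G|%:R = (2 ^ n)%:R * r /\
  (forall i j : 'I_(2 ^ n), i \in G -> j \notin G ->
     error_prob (subchannel W n i) <= error_prob (subchannel W n j)).

(* Main.v *)
(** Every polarization step replaces the entropy h of a channel by two entropies
h0 and h1 with h0 + h1 = 2h and h <= h0 <= 2h - h^2.  The upper bound on h0,
attained by the erasure channel, is a pointwise inequality for the binary
entropy: if I(x) is the information of a binary distribution with bias x, then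
I(x) I(y) <= I(xy) I(1).  Hence, for a concave g satisfying
  (g(x^2) + g(2x - x^2)) / 2 >= (211/256) g(x)  on [0,1],
the sum of g over the entropies of the N = 2^n subchannels of W is at least
N (211/256)^n g(H(W)), and (211/256)^n >= N^(-12/43) >= N^(-1/3.579).

Such a g exists with g(x) <= K min(x, 1 - x): it is a minimum of finitely many
affine functions.  A good index then contributes at most K H_i and a bad one at
most K (1 - H_i).  Since H_i is at most a constant times E_i/t + t for every t
in (0,1], the good indices contribute O(sqrt(P_e N)) altogether, which is
negligible against N^(1 - 1/3.579), and what remains bounds the loss of
capacity N (I(W) - R) from below. *)
From Stdlib Require Import BinInt.
Require Import Defs.
From mathcomp Require Import all_boot all_order all_algebra.
From mathcomp Require Import ssrZ ring lra.
From mathcomp Require Import boolp classical_sets functions cardinality fsbigop.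
From mathcomp Require Import reals ereal topology normedtype derive esum.
From mathcomp Require Import realfun exp.

Set Implicit Arguments.
Unset Strict Implicit.
Unset Printing Implicit Defensive.

Import Order.TTheory GRing.Theory Num.Theory numFieldNormedType.Exports.
Local Open Scope ring_scope.

(* [%Z] is the scope of MathComp's unary [int]. *)
Delimit Scope Z_scope with BinZ.

(** * A concave contraction function *)

Section IntegerEnvelope.
Implicit Types (p : Z * Z) (s : seq (Z * Z)).

(** Homogeneous form: d times the value at x/d of the affine function p. With denominators cleared,
    the tests below are decided by integer computation. *)
Definition chordZ (d x : Z) p : Z := (p.1 * (d - x) + p.2 * x)%BinZ.

Definition envelopeZ (p0 : Z * Z) s (d x : Z) : Z :=
  foldr (fun p => Z.min (chordZ d x p)) (chordZ d x p0) s.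

(** The products ab and a + b - ab of fractions over d have denominator d^2. They are the polar
    forms of x^2 and 2x - x^2. *)
Definition gainZ (p0 : Z * Z) s (d a b : Z) : Z :=
  (envelopeZ p0 s (d * d) (a * b)
   + envelopeZ p0 s (d * d) (d * (a + b) - a * b))%BinZ.

(* The points x^2 and 2x - x^2 are values of ab and a + b - ab on the diagonal.
   For x = (1-t)u + tv they are the combinations with weights (1-t)^2, 2t(1-t),
   t^2 of the values at (u,u), (u,v), (v,v); as the envelope is concave, it
   suffices to test these three points, against one affine function above the
   envelope. *)
Definition cell_ok (p0 : Z * Z) s (d : Z) (c : Z * Z) : bool :=
  let: (u, v) := c in
  let gains := [:: (u, u, gainZ p0 s d u u); (u, v, gainZ p0 s d u v);
                   (v, v, gainZ p0 s d v v)] in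
  has (fun p => all (fun t =>
    (211 * d * (chordZ d t.1.1 p + chordZ d t.1.2 p) <=? 256 * t.2)%BinZ) gains)
    (p0 :: s).

End IntegerEnvelope.

Section Envelope.
Variable R : realType.
Implicit Types (x y : R) (p : Z * Z).

Definition zr (z : Z) : R := (int_of_Z z)%:~R.

Lemma zrD a b : zr (a + b)%BinZ = zr a + zr b.
Proof. by rewrite /zr (rmorphD int_of_Z) intrD. Qed.

Lemma zrB a b : zr (a - b)%BinZ = zr a - zr b.
Proof. by rewrite /zr (rmorphB int_of_Z) intrB. Qed.

Lemma zrM a b : zr (a * b)%BinZ = zr a * zr b.
Proof. by rewrite /zr (rmorphM int_of_Z) intrM. Qed.

Lemma zr_le a b : (a <=? b)%BinZ -> zr a <= zr b.
Proof.
move=> ab; rewrite ler_int -subr_ge0 -rmorphB.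
have : (0 <=? b - a)%BinZ by move: ab => /Z.leb_le ab; apply/Z.leb_le/Z.le_0_sub.
by rewrite -[(b - a)%R]/(b - a)%BinZ; case: (b - a)%BinZ.
Qed.

Lemma zr_min a b : zr (Z.min a b) = Num.min (zr a) (zr b).
Proof.
have [ab|/Z.lt_le_incl ba] := Z.leb_spec a b.
  by rewrite Z.min_l // min_l // zr_le //; apply/Z.leb_le.
by rewrite Z.min_r // min_r // zr_le //; apply/Z.leb_le.
Qed.

Definition chord x p : R := zr p.1 * (1 - x) + zr p.2 * x.

(** The first node that is at least x closes a cell containing x, as the node before it lies to the
    left of x. *)
Lemma grid_cover (s : seq Z) (u : Z) x : zr u <= x <= zr (last u s) ->
  s != [::] -> exists2 c, c \in zip (u :: s) s & zr c.1 <= x <= zr c.2.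
Proof.
elim: s u => // v s IH u /= /andP[ux xs] _.
have [xv|/ltW vx] := leP x (zr v).
  by exists (u, v); rewrite ?mem_head //= ux.
case: s IH xs => [_ /= xv|w s IH xs].
  by exists (u, v); rewrite ?mem_head //= ux.
have [|//|c cs cx] := IH v; first by rewrite vx.
by exists c => //; rewrite in_cons cs orbT.
Qed.

Variables (p0 : Z * Z) (s : seq (Z * Z)).

Definition envelope x : R :=
  foldr (fun p => Num.min (chord x p)) (chord x p0) s.

Lemma chordZE d (x : Z) p : 0 < zr d ->
  zr (chordZ d x p) = zr d * chord (zr x / zr d) p.
Proof.
move=> d0; rewrite /chordZ /chord !(zrD, zrB, zrM); field.
by rewrite gt_eqF.
Qed.

Lemma envelopeZE d (x : Z) : 0 < zr d ->
  zr (envelopeZ p0 s d x) = zr d * envelope (zr x / zr d).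
Proof.
move=> d0; rewrite /envelopeZ /envelope.
elim: s => [|p s' IH]; first exact: chordZE.
by rewrite [foldr _ _ _]/= zr_min IH chordZE //= minr_pMr // ltW.
Qed.

Lemma le_envelope y x :
  (y <= envelope x) = all (fun p => y <= chord x p) (p0 :: s).
Proof.
have memE s' : (y <= foldr (fun p => Num.min (chord x p)) (chord x p0) s') =
    all (fun p => y <= chord x p) (p0 :: s').
  elim: s' => [|p s' IH] /=; first by rewrite andbT.
  by rewrite le_min IH /= andbCA.
by rewrite /envelope memE.
Qed.

Lemma envelope_le x p : p \in (p0 :: s) -> envelope x <= chord x p.
Proof. by move=> ps; have := lexx (envelope x); rewrite le_envelope => /allP ->. Qed.

Lemma chord_conv x y t p :
  chord ((1 - t) * x + t * y) p = (1 - t) * chord x p + t * chord y p.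
Proof. by rewrite /chord; ring. Qed.

Lemma envelope_concave x y t : 0 <= t <= 1 ->
  (1 - t) * envelope x + t * envelope y <= envelope ((1 - t) * x + t * y).
Proof.
move=> /andP[t0 t1]; rewrite le_envelope; apply/allP => p ps.
by rewrite chord_conv lerD // ler_wpM2l ?subr_ge0 // envelope_le.
Qed.

(** Swapping the end values of an affine function reflects its graph, so each reflected line is
    again in the family. One inequality suffices because the reflection is an involution. *)
Lemma envelope_sym x :
  all (fun p => (p.2, p.1) \in p0 :: s) (p0 :: s) ->
  envelope (1 - x) = envelope x.
Proof.
move=> /allP symm.
have le_sym z : envelope z <= envelope (1 - z).
  rewrite le_envelope; apply/allP => p /symm ps.
  apply: le_trans (envelope_le z ps) _.
  by rewrite /chord /=; lra.
by have := le_sym (1 - x); rewrite subKr => h; apply/le_anti; rewrite h le_sym.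
Qed.

(** Each line is at least (p.1 + p.2) min(x, 1 - x), hence at least min(x, 1 - x). *)
Lemma envelope_gt0 x :
  all (fun p => [&& 0 <=? p.1, 0 <=? p.2 & 1 <=? p.1 + p.2]%BinZ) (p0 :: s) ->
  0 < x < 1 -> 0 < envelope x.
Proof.
move=> /allP pos /andP[x0 x1].
apply: (@lt_le_trans _ _ (Num.min x (1 - x))).
  by rewrite lt_min x0 subr_gt0.
rewrite le_envelope; apply/allP => p /pos /and3P[/zr_le p1 /zr_le p2 /zr_le].
have z0 : zr 0%BinZ = 0 by []. have z1 : zr 1%BinZ = 1 by [].
move: p1 p2; rewrite zrD z0 z1 /chord => p1 p2 p12.
have m1 : Num.min x (1 - x) <= x by rewrite ge_min lexx.
have m2 : Num.min x (1 - x) <= 1 - x by rewrite ge_min lexx orbT.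
have : 0 <= Num.min x (1 - x) by rewrite le_min; lra.
nra.
Qed.

Lemma cell_gain d u v t x : 0 < zr d -> cell_ok p0 s d (u, v) -> 0 <= t <= 1 ->
  x = (1 - t) * (zr u / zr d) + t * (zr v / zr d) ->
  211 * envelope x <= 128 * (envelope (x ^+ 2) + envelope (2 * x - x ^+ 2)).
Proof.
move=> D0 ok /andP[t0 t1] xE.
have DD0 : 0 < zr (d * d)%BinZ by rewrite zrM mulr_gt0.
have gainE a b : zr (gainZ p0 s d a b) = zr d ^+ 2 *
    (envelope (zr a / zr d * (zr b / zr d)) +
     envelope (zr a / zr d + zr b / zr d
               - zr a / zr d * (zr b / zr d))).
  rewrite /gainZ zrD !envelopeZE // !(zrB, zrM, zrD) [RHS]mulrDr expr2.
  by congr (_ * _ * envelope _ + _ * _ * envelope _); field; rewrite gt_eqF.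
move: ok => /hasP[p ps] /and4P[/zr_le + /zr_le + /zr_le + _].
rewrite !zrM !gainE !(zrD (chordZ _ _ _)) !chordZE //.
set a := zr u / _ in xE *; set b := zr v / _ in xE *.
have -> : zr 211%BinZ = 211 by []. have -> : zr 256%BinZ = 256 by [].
set D := zr d in D0 *.
(* Both sides of an integer test carry the factor d^2. *)
have norm k l m : 211 * D * (D * k + D * l) <= 256 * (D ^+ 2 * m) ->
    211 * (k + l) <= 256 * m.
  move=> h; rewrite -(ler_pM2l (exprn_gt0 2 D0)).
  by move: h; congr (_ <= _); ring.
move=> /norm uu /norm uv /norm vv.
have s0 : 0 <= 1 - t by rewrite subr_ge0.
(* Jensen's inequality for the Bernstein weights of degree 2, which sum to 1. *)
have env_bern q0 q1 q2 :
    (1 - t) ^+ 2 * envelope q0 + 2 * (t * (1 - t)) * envelope q1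
      + t ^+ 2 * envelope q2
    <= envelope ((1 - t) ^+ 2 * q0 + 2 * (t * (1 - t)) * q1 + t ^+ 2 * q2).
  rewrite le_envelope; apply/allP => q qs.
  have -> : chord ((1 - t) ^+ 2 * q0 + 2 * (t * (1 - t)) * q1 + t ^+ 2 * q2) q
    = (1 - t) ^+ 2 * chord q0 q + 2 * (t * (1 - t)) * chord q1 q
      + t ^+ 2 * chord q2 q by rewrite /chord; ring.
  by rewrite !lerD // ler_wpM2l ?envelope_le // ?exprn_ge0 // !mulr_ge0.
have := env_bern (a * a) (a * b) (b * b).
have := env_bern (a + a - a * a) (a + b - a * b) (b + b - b * b).
have -> : (1 - t) ^+ 2 * (a * a) + 2 * (t * (1 - t)) * (a * b)
  + t ^+ 2 * (b * b) = x ^+ 2 by rewrite xE; ring.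
have -> : (1 - t) ^+ 2 * (a + a - a * a) + 2 * (t * (1 - t)) * (a + b - a * b)
  + t ^+ 2 * (b + b - b * b) = 2 * x - x ^+ 2 by rewrite xE; ring.
have := envelope_le x ps; rewrite {2}xE chord_conv.
have {}uu := ler_wpM2l (exprn_ge0 2 s0) uu.
have {}uv := ler_wpM2l (mulr_ge0 t0 s0) uv.
have {}vv := ler_wpM2l (exprn_ge0 2 t0) vv.
move: uu uv vv; set pa := chord a p; set pb := chord b p.
set e0 := envelope (a * a); set e1 := envelope (a * b).
set e2 := envelope (b * b); set f0 := envelope (a + a - _).
set f1 := envelope (a + b - _); set f2 := envelope (b + b - _).
move=> uu uv vv ex ef ee; nra.
Qed.

Lemma envelope_gain d g x : 0 < zr d ->
  all (fun p => (p.2, p.1) \in p0 :: s) (p0 :: s) ->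
  all (cell_ok p0 s d) (zip (0%BinZ :: g) g) ->
  (d <=? 2 * last 0 g)%BinZ -> 0 <= x <= 1 ->
  211 * envelope x <= 128 * (envelope (x ^+ 2) + envelope (2 * x - x ^+ 2)).
Proof.
move=> d0 symm /allP cells_ok /zr_le; rewrite zrM => lastE.
(* Replacing x by 1 - x exchanges x^2 and 2x - x^2 up to reflection, so the left half of the
   interval suffices. *)
wlog xle : x / x <= 2^-1 => [hw /andP[x0 x1]|/andP[x0 _]].
  have [xle|xgt] := leP x 2^-1; first by apply: hw; rewrite // x0.
  have := hw (1 - x); rewrite envelope_sym // -(envelope_sym (x ^+ 2)) //.
  rewrite -(envelope_sym (2 * x - _)) //.
  have -> : 2 * (1 - x) - (1 - x) ^+ 2 = 1 - x ^+ 2 by ring.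
  have -> : 1 - (2 * x - x ^+ 2) = (1 - x) ^+ 2 by ring.
  by move=> hx; rewrite [X in _ <= _ * X]addrC; apply: hx; lra.
have z2 : zr 2%BinZ = 2 by [].
have gx : zr 0%BinZ <= zr d * x <= zr (last 0%BinZ g).
  rewrite mulr_ge0 ?(ltW d0) //= -(ler_pM2l (ltr0Sn R 1)) -z2.
  apply: le_trans lastE; rewrite z2 mulrCA ler_piMr ?(ltW d0) //; lra.
have g0 : g != [::].
  by case: (g) lastE => //=; rewrite [zr 0%BinZ]/(0 : R) mulr0 leNgt d0.
have [[u v] /cells_ok ok /= /andP[ux xv]] := grid_cover gx g0.
(* In a cell reduced to a point the interpolation parameter below would have denominator 0. *)
have [uv|uv] := eqVneq (zr u) (zr v).
  apply: (cell_gain (t := 0) d0 ok); first by rewrite lexx ler01.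
  have -> : zr u = zr d * x by apply/le_anti; rewrite ux uv.
  by field; rewrite gt_eqF.
have uv0 : 0 < zr v - zr u by rewrite subr_gt0 lt_neqAle uv (le_trans ux xv).
apply: (cell_gain (t := (zr d * x - zr u) / (zr v - zr u)) d0 ok).
  rewrite ler_pdivrMr // divr_ge0 ?subr_ge0 ?(le_trans ux xv) //=; lra.
by field; rewrite !gt_eqF.
Qed.

End Envelope.

(* A pair (a, b) stands for the affine function with value a at 0 and b at 1.
   These are rounded chords, on the left half of [0,1], of an approximation of
   the top eigenfunction of g |-> (g(x^2) + g(2x - x^2)) / 2, thinned out as much
   as the factor 211/256 allows. *)
Definition lines : seq (Z * Z) := [::
  (39, 334189); (45, 316168); (55, 293725); (65, 275908); (72, 265559);
  (83, 251077); (99, 234974); (111, 225003); (133, 209644); (142, 205020);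
  (165, 193741); (184, 185478); (197, 180570); (235, 168779); (296, 154329);
  (344, 145585); (370, 141536); (498, 125891); (555, 120516); (652, 112936);
  (860, 100573); (972, 95377); (1117, 89644); (1165, 87964); (1417, 80428);
  (1532, 77542); (1768, 72471); (2107, 66531); (2581, 60015); (2692, 58710);
  (3133, 54182); (3802, 48682); (4488, 44161); (5214, 40289); (5833, 37510);
  (6501, 34902); (7311, 32183); (7766, 30817); (8631, 28508); (9784, 25891);
  (10413, 24636); (11235, 23133); (12678, 20841); (14672, 18223);
  (15736, 17032)]%BinZ.

(** This line vanishes at 0. Together with its mirror image it yields the bound K min(x, 1 - x) with
    K = 485423. *)
Definition line0 : Z * Z := (0, 485423)%BinZ.

Definition other_lines : seq (Z * Z) :=
  lines ++ [seq (p.2, p.1) | p <- line0 :: lines].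

(** Nodes over the denominator 2^20, capped at 2^19, that is at 1/2. The steps grow by a factor of
    about 25/24, so the cells are finest near 0, where the lines are steepest. *)
Definition grid : seq Z :=
  traject (fun u => Z.min 524288 (u + u / 24 + 1))%BinZ 256%BinZ 187.

Lemma lines_sym : all (fun p => (p.2, p.1) \in line0 :: other_lines)
  (line0 :: other_lines).
Proof. by vm_compute. Qed.

Lemma lines_pos :
  all (fun p => [&& 0 <=? p.1, 0 <=? p.2 & 1 <=? p.1 + p.2]%BinZ)
    (line0 :: other_lines).
Proof. by vm_compute. Qed.

Lemma grid_ok :
  all (cell_ok line0 other_lines 1048576%BinZ) (zip (0%BinZ :: grid) grid).
Proof. by vm_compute. Qed.

Lemma grid_last : (1048576 <=? 2 * last 0 grid)%BinZ.
Proof. by vm_compute. Qed.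

(** Since 332 = 8 · 43 - 12, this says that 211/256 is at least 2^(-12/43). *)
Lemma pow_211_43 (R : realType) : 2 ^+ 332 <= 211 ^+ 43 :> R.
Proof.
have zrX (a : Z) n : zr R (a ^+ n) = zr R a ^+ n.
  by rewrite /zr (rmorphXn int_of_Z) rmorphXn.
have le : ((2%BinZ : Z) ^+ 332 <=? (211%BinZ : Z) ^+ 43)%BinZ by vm_compute.
by have := @zr_le R _ _ le; rewrite !zrX.
Qed.

Lemma contraction_function (R : realType) : exists (g : R -> R) (K : R),
  [/\ 0 < K,
      forall x, 0 < x < 1 -> 0 < g x,
      forall x, g x <= K * x /\ g x <= K * (1 - x),
      forall x y t, 0 <= t <= 1 ->
        (1 - t) * g x + t * g y <= g ((1 - t) * x + t * y)
    & forall x, 0 <= x <= 1 ->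
        211 * g x <= 128 * (g (x ^+ 2) + g (2 * x - x ^+ 2))].
Proof.
have K0 : 0 < zr R 485423%BinZ.
  by apply: (lt_le_trans ltr01 (@zr_le R 1%BinZ _ _)).
have le_K x : envelope line0 other_lines x <= zr R 485423%BinZ * x.
  apply: le_trans (envelope_le _ (mem_head _ _)) _.
  by rewrite /chord mul0r add0r.
exists (@envelope R line0 other_lines), (zr R 485423%BinZ); split=> //.
- by move=> x x01; apply: envelope_gt0 => //; exact: lines_pos.
- by move=> x; rewrite -{2}(envelope_sym x lines_sym).
- by move=> x y t t01; apply: envelope_concave.
- move=> x; apply: (@envelope_gain _ _ _ 1048576%BinZ grid).
  + by apply: (lt_le_trans ltr01 (@zr_le R 1%BinZ _ _)).
  + exact: lines_sym.
  + exact: grid_ok.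
  + exact: grid_last.
Qed.

(** * The binary entropy function *)

Section Unimodal.
Local Open Scope classical_set_scope.
Variable R : realType.
Implicit Types (f df : R -> R) (a x y : R).

(** The derivative changes sign at most once, from plus to minus. So f is nondecreasing on [0,x] or
    nonincreasing on [x,a], and f(x) is at least one of the two end values. *)
Lemma unimodal_ge0 f df a x :
  (forall y, 0 < y < a -> is_derive y 1 f (df y)) ->
  {within `[0, a], continuous f} ->
  (forall y z, 0 < y -> y <= z -> z < a -> 0 <= df z -> 0 <= df y) ->
  0 <= f 0 -> 0 <= f a -> 0 <= x <= a -> 0 <= f x.
Proof.
move=> fd fc sgn f0 fa /andP[].
rewrite [0 <= x]le_eqVlt [x <= a]le_eqVlt.
move=> /predU1P[<-//|x0] /predU1P[->//|xa].
have drv y : 0 < y < a -> derivable f y 1 /\ derive1 f y = df y.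
  by move=> /fd h; split; [exact: ex_derive | rewrite derive1E derive_val].
have [dx|dx] := leP 0 (df x).
  apply: le_trans f0 _.
  apply: (@ger0_derive1_le_cc _ f 0 x) => [y|y||||]; rewrite ?in_itv /=;
    rewrite ?lexx ?(ltW x0) //.
  - by move=> /andP[y0 yx]; apply: (drv _ _).1; rewrite y0 (lt_trans yx).
  - move=> /andP[y0 yx]; rewrite (drv _ _).2 ?y0 ?(lt_trans yx) //.
    by apply: sgn dx => //; exact: ltW.
  - apply: continuous_subspaceW fc; apply: subset_itvl.
    by rewrite bnd_simp ltW.
apply: le_trans fa _.
apply: (@ler0_derive1_le_cc _ f x a) => [y|y||||]; rewrite ?in_itv /=;
    rewrite ?lexx ?(ltW xa) //.
- by move=> /andP[xy ya]; apply: (drv _ _).1; rewrite ya (lt_trans x0).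
- move=> /andP[xy ya]; rewrite (drv _ _).2 ?ya ?(lt_trans x0) //.
  rewrite leNgt; apply/negP => /ltW /(sgn x y x0 (ltW xy) ya).
  by rewrite leNgt dx.
- apply: continuous_subspaceW fc; apply: subset_itvr.
  by rewrite bnd_simp ltW.
Qed.

End Unimodal.

Section BinaryEntropy.
Local Open Scope classical_set_scope.
Variable R : realType.
Implicit Types a b x y z : R.

Definition xlnx x := x * ln x.

(** Twice the capacity, in nats, of the binary symmetric channel with crossover probability (1 -
    a)/2. *)
Definition information a := xlnx (1 + a) + xlnx (1 - a).

(** The derivative of [information], equal to 2 artanh a. *)
Definition log_ratio a := ln (1 + a) - ln (1 - a).

Lemma is_derive_affine (c x : R) : is_derive x 1 (fun y => 1 + c * y) c.
Proof.
have -> : (fun y => 1 + c * y) = cst 1 + c *: (@id R) by apply/funext.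
have := is_deriveD (is_derive_cst (1 : R) x 1) (is_deriveZ c (is_derive_id x 1)).
by rewrite /GRing.scale /= add0r mulr1.
Qed.

Lemma is_derive_ln1D (c x : R) : 0 < 1 + c * x ->
  is_derive x 1 (fun y => ln (1 + c * y)) (c / (1 + c * x)).
Proof.
move=> h.
have h1 : is_derive x 1 (fun y => 1 + c * y) c.
  exact: is_derive_affine.
have h2 := is_derive1_ln h.
by apply: is_derive_eq; rewrite mulrC.
Qed.

Lemma is_derive_log_ratio b x : -1 < b * x < 1 ->
  is_derive x 1 (fun y => log_ratio (b * y)) (2 * b / (1 - (b * x) ^+ 2)).
Proof.
move=> /andP[h1 h2].
have d1 : is_derive x 1 (fun y => ln (1 + b * y)) (b / (1 + b * x)).
  by apply: is_derive_ln1D; lra.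
have d2 : is_derive x 1 (fun y => ln (1 + - b * y)) (- b / (1 + - b * x)).
  by apply: is_derive_ln1D; lra.
have -> : (fun y => log_ratio (b * y)) =
    (fun y => ln (1 + b * y)) - (fun y => ln (1 + - b * y)).
  by apply/funext => y; rewrite /log_ratio !fctE mulNr.
apply: is_derive_eq; field.
by rewrite -[X in X - _](expr1n _ 2) subr_sqr mulf_neq0 //= ; lra.
Qed.

Lemma is_derive_information b x : -1 < b * x < 1 ->
  is_derive x 1 (fun y => information (b * y)) (b * log_ratio (b * x)).
Proof.
move=> /andP[h1 h2].
have d1 : is_derive x 1 (fun y => ln (1 + b * y)) (b / (1 + b * x)).
  by apply: is_derive_ln1D; lra.
have d2 : is_derive x 1 (fun y => ln (1 + - b * y)) (- b / (1 + - b * x)).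
  by apply: is_derive_ln1D; lra.
have e (c : R) : is_derive x 1 (fun y => 1 + c * y) c.
  exact: is_derive_affine.
have e1 := e b; have e2 := e (- b).
have -> : (fun y => information (b * y)) =
    (fun y => 1 + b * y) * (fun y => ln (1 + b * y))
    + (fun y => 1 + - b * y) * (fun y => ln (1 + - b * y)).
  by apply/funext => y; rewrite /information /xlnx /= !fctE !mulNr.
apply: is_derive_eq (is_deriveD (is_deriveM e1 d1) (is_deriveM e2 d2)) _.
rewrite /log_ratio -mulNr /GRing.scale /=; field.
by apply/andP; split; lra.
Qed.

Lemma xlnx_le0 x : 0 <= x <= 1 -> xlnx x <= 0.
Proof. by move=> /andP[x0 x1]; rewrite mulr_ge0_le0 // ln_le0. Qed.

(** With r the square root of x, ln x = 2 ln r is at most 2r, and 2r is at most 1/t + t r^2 by the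
    inequality of means. *)
Lemma ln_le_inv_add x (t : R) : 0 < x -> 0 < t -> ln x <= t^-1 + t * x.
Proof.
move=> x0 t0.
have r0 : 0 < Num.sqrt x by rewrite sqrtr_gt0.
have -> : ln x = 2 * ln (Num.sqrt x).
  by rewrite -{1}(sqr_sqrtr (ltW x0)) lnXn // mulr_natl.
have lnr := ltW (ln_sublinear r0).
apply: (@le_trans _ _ (2 * Num.sqrt x)); first by rewrite ler_pM2l.
rewrite -{2}(sqr_sqrtr (ltW x0)); set r := Num.sqrt x.
have -> : t^-1 + t * r ^+ 2 = 2 * r + t * (r - t^-1) ^+ 2.
  by field; rewrite gt_eqF.
by rewrite lerDl mulr_ge0 ?sqr_ge0 // ltW.
Qed.

(** The case of 1/x and t = sqrt x in [ln_le_inv_add]; for x <= 0 the value of [ln] is 0. This gives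
    two-sided continuity of [xlnx] at 0. *)
Lemma xlnx_bound x : `|x| <= 1 -> `|xlnx x| <= 2 * Num.sqrt `|x|.
Proof.
have [x0 _|x0] := leP x 0; first by rewrite /xlnx ln0 // mulr0 normr0 mulr_ge0 // sqrtr_ge0.
rewrite (gtr0_norm x0) => x1.
have r0 : 0 < Num.sqrt x by rewrite sqrtr_gt0.
rewrite ler0_norm ?xlnx_le0 ?x1 ?(ltW x0) //.
have v0 : 0 < x^-1 by rewrite invr_gt0.
have := ln_le_inv_add v0 r0; rewrite lnV // -(ler_pM2l x0) /xlnx -mulrN.
move=> /le_trans; apply; rewrite mulrDr [x * (_ * _)]mulrCA divff ?gt_eqF //.
by rewrite -[X in X / _](sqr_sqrtr (ltW x0)) expr2 mulfK ?gt_eqF //; lra.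
Qed.

Lemma continuous_xlnx x : 0 <= x -> {for x, continuous xlnx}.
Proof.
rewrite le_eqVlt => /predU1P[<-|x0]; last first.
  by apply: continuousM; [exact: cvg_id | exact: continuous_ln].
have xlnx0 : xlnx 0 = 0 by rewrite /xlnx mul0r.
suff : xlnx y @[y --> 0] --> (0 : R) by rewrite -[X in _ --> X -> _]xlnx0.
apply/cvgr0Pnorm_lt => e e0; near=> y.
have e2 : 0 < e / 2 by rewrite divr_gt0.
have y1 : `|y| <= 1 by near: y; exact: (@nbhs0_le R R^o).
apply: le_lt_trans (xlnx_bound y1) _.
have ye : `|y| < (e / 2) ^+ 2 by near: y; apply: (@nbhs0_lt R R^o); rewrite exprn_gt0 ?divr_gt0.
suff : Num.sqrt `|y| < e / 2 by lra.
by rewrite -[ltRHS](ger0_norm (ltW e2)) -(sqrtr_sqr (e / 2)) ltr_sqrt // exprn_gt0.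
Unshelve. all: end_near. Qed.

Lemma continuous_information b x : 0 <= b <= 1 -> 0 <= x <= 1 ->
  continuous_at x (fun y => information (b * y)).
Proof.
move=> /andP[b0 b1] /andP[x0 x1].
have cM c : {for x, continuous (fun y => 1 + c * y)}.
  apply: differentiable_continuous; apply/derivable1_diffP.
  by apply: ex_derive; exact: is_derive_affine.
have bx0 : 0 <= b * x by rewrite mulr_ge0.
have bx1 : b * x <= 1 by rewrite mulr_ile1.
have -> : (fun y => information (b * y)) =
    (xlnx \o (fun y => 1 + b * y)) + (xlnx \o (fun y => 1 + - b * y)).
  by apply/funext => y; rewrite /information !fctE /= mulNr.
by apply: continuousD; apply: continuous_comp; try exact: cM;
  apply: continuous_xlnx => /=; lra.
Qed.

Lemma information0 : information 0 = 0.
Proof. by rewrite /information /xlnx addr0 subr0 ln1 mulr0 addr0. Qed.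

Lemma information1 : information 1 = 2 * ln 2.
Proof. by rewrite /information /xlnx subrr mul0r addr0. Qed.

Lemma log_ratio_gt0 x : 0 < x < 1 -> 0 < log_ratio x.
Proof.
move=> /andP[x0 x1]; rewrite subr_gt0 ltr_ln ?posrE; lra.
Qed.

Lemma log_ratio_le x y : 0 <= x -> x <= y -> y < 1 -> log_ratio x <= log_ratio y.
Proof.
by move=> x0 xy y1; rewrite lerB // ler_ln ?posrE; lra.
Qed.

(** The quotient of [log_ratio] at bz and at z is nonincreasing in z. For fixed y, the cross
    difference f vanishes at 0 and at y and is unimodal between them. *)
Lemma log_ratio_cross b x y : 0 <= b <= 1 -> 0 < x -> x <= y -> y < 1 ->
  log_ratio (b * y) * log_ratio x <= log_ratio (b * x) * log_ratio y.
Proof.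
move=> /andP[b0 b1] x0 xy y1; rewrite -subr_ge0.
pose f z := log_ratio (b * z) * log_ratio y - log_ratio (b * y) * log_ratio z.
pose df z := 2 * b / (1 - (b * z) ^+ 2) * log_ratio y
             - log_ratio (b * y) * (2 / (1 - z ^+ 2)).
have y0 : 0 < y by lra.
have fd z : -1 < z < 1 -> is_derive z 1 f (df z).
  move=> z11; have bz : -1 < b * z < 1 by nra.
  have d1 := is_derive_log_ratio bz.
  have d2 : is_derive z 1 (fun z => log_ratio (1 * z)) (2 * 1 / (1 - (1 * z) ^+ 2)).
    by apply: is_derive_log_ratio; rewrite mul1r.
  have -> : f = log_ratio y *: (fun z => log_ratio (b * z))
                - log_ratio (b * y) *: (fun z => log_ratio (1 * z)).
    by apply/funext => w; rewrite /f !fctE mul1r mulrC.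
  by apply: is_derive_eq; rewrite /df /GRing.scale /= !mul1r mulr1 [_ * log_ratio y]mulrC.
rewrite -[X in 0 <= X]/(f x).
apply: (@unimodal_ge0 _ f df y x) => //; last 3 first.
- by rewrite /f !mulr0 /log_ratio !(addr0, subr0) !subrr mul0r mulr0 subrr.
- by rewrite /f subrr.
- by rewrite (ltW x0).
- by move=> z /andP[z0 zy]; apply: fd; lra.
- apply: derivable_within_continuous => z; rewrite in_itv /= => /andP[z0 zy].
  by apply: ex_derive; apply: fd; lra.
move=> z w z0 zw wy.
have sq1 (c v : R) : 0 <= c <= 1 -> 0 < v -> v < 1 -> 0 < 1 - (c * v) ^+ 2.
  move=> /andP[c0 c1] v0 v1; have : c * v < 1 by nra.
  have : 0 <= c * v by nra. nra.
(* With the positive denominators cleared, the sign condition is affine in v^2. *)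
have dfE v : 0 < v -> v < 1 -> (0 <= df v) =
    (log_ratio (b * y) * (1 - (b * v) ^+ 2) <= b * log_ratio y * (1 - v ^+ 2)).
  move=> v0 v1; have p1 : 0 < 1 - (b * v) ^+ 2 by apply: sq1; lra.
  have p2 : 0 < 1 - v ^+ 2 by have := @sq1 1 v; rewrite mul1r; apply; lra.
  have -> : df v = 2 / ((1 - (b * v) ^+ 2) * (1 - v ^+ 2)) *
    (b * log_ratio y * (1 - v ^+ 2) - log_ratio (b * y) * (1 - (b * v) ^+ 2)).
    by rewrite /df; field; rewrite !gt_eqF.
  by rewrite pmulr_rge0 ?subr_ge0 // divr_gt0 // mulr_gt0.
rewrite !dfE; try lra.
have ge0 : 0 <= log_ratio (b * y).
  by have := @log_ratio_le 0 (b * y); rewrite {1}/log_ratio addr0 subr0 subrr; apply; nra.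
have le : log_ratio (b * y) <= log_ratio y by apply: log_ratio_le; nra.
have z2 : z ^+ 2 <= w ^+ 2 by rewrite !expr2; nra.
(* The condition gets harder as v^2 grows, so it passes from w down to z. *)
have : 0 <= (w ^+ 2 - z ^+ 2) * (b * (log_ratio y - b * log_ratio (b * y))).
  by rewrite mulr_ge0 ?subr_ge0 // mulr_ge0 // subr_ge0; nra.
rewrite !exprMn; lra.
Qed.

Lemma information_le x y : 0 <= x -> x <= y -> y <= 1 ->
  information x <= information y.
Proof.
move=> x0 xy y1.
have drv z : 0 < z < 1 -> is_derive z 1 information (log_ratio z).
  move=> /andP[z0 z1]; have := @is_derive_information 1 z.
  rewrite !mul1r; under eq_fun do rewrite mul1r.
  by apply; lra.
apply: (@ger0_derive1_le_cc _ information 0 1) => // [z|z|||].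
- by rewrite in_itv => /drv d; exact: ex_derive.
- rewrite in_itv /= => z01; have d := drv _ z01.
  by rewrite derive1E derive_val ltW ?log_ratio_gt0.
- apply/continuous_in_subspaceT => z; rewrite inE /= in_itv /= => z01.
  rewrite (_ : information = (fun y => information (1 * y))).
    by apply: continuous_information => //; rewrite ler01 lexx.
  by apply/funext => w; rewrite mul1r.
- by rewrite in_itv /= x0 (le_trans xy).
- by rewrite in_itv /= y1 (le_trans x0).
Qed.

Lemma information_ge0 x : 0 <= x <= 1 -> 0 <= information x.
Proof. by move=> /andP[x0 x1]; rewrite -information0 information_le. Qed.

(** As a function of a, the difference of the two sides vanishes at 0 and at 1. The monotone
    quotient of [log_ratio_cross] makes its derivative change sign only once. *)
Lemma information_mul a b : 0 <= a <= 1 -> 0 <= b <= 1 ->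
  information a * information b <= information (a * b) * information 1.
Proof.
move=> a01 b01; have /andP[b0 b1] := b01; rewrite -subr_ge0.
pose f x := information 1 * information (b * x) - information b * information (1 * x).
pose df x := information 1 * (b * log_ratio (b * x)) - information b * (1 * log_ratio (1 * x)).
have -> : information (a * b) * information 1 - information a * information b = f a.
  by rewrite /f mul1r [b * a]mulrC; ring.
have i1 : 0 < information 1 by rewrite information1 mulr_gt0 // ln_gt0 // ltr1n.
refine (@unimodal_ge0 _ f df 1 a _ _ _ _ _ a01).
- move=> z /andP[z0 z1].
  have d1 : is_derive z 1 (fun y => information (b * y)) (b * log_ratio (b * z)).
    by apply: is_derive_information; nra.
  have d2 : is_derive z 1 (fun y => information (1 * y)) (1 * log_ratio (1 * z)).
    by apply: is_derive_information; lra.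
  exact: (is_deriveB (is_deriveZ (information 1) d1) (is_deriveZ (information b) d2)).
- apply/continuous_in_subspaceT => z; rewrite inE /= in_itv /= => z01.
  have c1 := continuous_information b01 z01.
  have c2 : continuous_at z (fun y => information (1 * y)).
    by apply: continuous_information z01; rewrite ler01 lexx.
  exact: (cvgB (cvgM (cvg_cst _) c1) (cvgM (cvg_cst _) c2)).
- move=> y z y0 yz z1; rewrite /df !mul1r !subr_ge0 => zz.
  have ty : 0 < log_ratio y by rewrite log_ratio_gt0 // y0 (le_lt_trans yz).
  have tz : 0 < log_ratio z by rewrite log_ratio_gt0 // z1 (lt_le_trans y0).
  rewrite -(ler_pM2r tz).
  have := ler_wpM2r (ltW ty) zz.
  have := ler_wpM2l (mulr_ge0 (ltW i1) b0) (log_ratio_cross b01 y0 yz z1).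
  by move=> h1 h2; lra.
- by rewrite /f !mulr0 information0 !mulr0 subrr.
- by rewrite /f !mulr1 mulrC subrr.
Qed.

(* [entropy2 a b] is the entropy, in nats, of the binary distribution
   proportional to (a, b), multiplied by its mass a + b. *)
Definition entropy2 a b := xlnx (a + b) - xlnx a - xlnx b.

Lemma xlnxM x y : 0 <= x -> 0 <= y -> xlnx (x * y) = x * xlnx y + y * xlnx x.
Proof.
rewrite /xlnx [0 <= x]le_eqVlt [0 <= y]le_eqVlt.
move=> /predU1P[<-|x0] /predU1P[<-|y0]; rewrite ?(mulr0, mul0r, addr0) //.
by rewrite lnM //; ring.
Qed.

Lemma xlnx_half : xlnx (2^-1) = - (ln 2 / 2) :> R.
Proof. by rewrite /xlnx lnV ?posrE //; field. Qed.

Lemma informationN x : information (- x) = information x.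
Proof. by rewrite /information opprK addrC. Qed.

Lemma information_norm x : information `|x| = information x.
Proof. by case: ler0P => // _; exact: informationN. Qed.

Lemma bias_le1 a b : 0 <= a -> 0 <= b -> 0 <= `|(a - b) / (a + b)| <= 1.
Proof.
move=> a0 b0; rewrite normr_ge0 /=.
have [->|s0] := eqVneq (a + b) 0; first by rewrite invr0 mulr0 normr0.
have s_gt0 : 0 < a + b by rewrite lt_neqAle eq_sym s0 addr_ge0.
rewrite normrM normfV (gtr0_norm s_gt0) ler_pdivrMr // mul1r ler_norml; lra.
Qed.

Lemma entropy2E a b : 0 <= a -> 0 <= b ->
  entropy2 a b = (a + b) * (ln 2 - information ((a - b) / (a + b)) / 2).
Proof.
move=> a0 b0; have [/eqP|s0] := eqVneq (a + b) 0.
  rewrite paddr_eq0 // => /andP[/eqP-> /eqP->].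
  by rewrite /entropy2 /xlnx !(addr0, mul0r, subr0).
have s_gt0 : 0 < a + b by rewrite lt_neqAle eq_sym s0 addr_ge0.
have := bias_le1 a0 b0; rewrite ler_norml normr_ge0 /=.
set x := (a - b) / (a + b); set s := a + b => /andP[x1 x2].
have -> : a = s / 2 * (1 + x) by rewrite /x /s; field.
have -> : b = s / 2 * (1 - x) by rewrite /x /s; field.
have p0 : 0 <= s by exact: ltW.
have h2 : 0 <= 2^-1 :> R by rewrite invr_ge0.
have p2 : 0 <= s / 2 by rewrite divr_ge0.
have p3 : 0 <= 1 + x by lra.
have p4 : 0 <= 1 - x by lra.
rewrite /entropy2 !xlnxM //.
rewrite {1}(_ : s / 2 * (1 + x) + s / 2 * (1 - x) = s); last by field.
by rewrite xlnx_half /information; field.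
Qed.

Lemma entropy2C a b : entropy2 a b = entropy2 b a.
Proof. by rewrite /entropy2 [b + a]addrC; ring. Qed.

Lemma ln2_gt0 : 0 < ln 2 :> R.
Proof. by rewrite ln_gt0 // ltr1n. Qed.

Lemma entropy2_ge0 a b : 0 <= a -> 0 <= b -> 0 <= entropy2 a b.
Proof.
move=> a0 b0; rewrite entropy2E // -information_norm.
apply: mulr_ge0; first exact: addr_ge0.
have /andP[x0 x1] := bias_le1 a0 b0.
by have := information_le x0 x1 (lexx 1); rewrite information1; lra.
Qed.

Lemma entropy2_le a b : 0 <= a -> 0 <= b -> entropy2 a b <= (a + b) * ln 2.
Proof.
move=> a0 b0; rewrite entropy2E // -information_norm ler_wpM2l ?addr_ge0 //.
by have := information_ge0 (bias_le1 a0 b0); lra.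
Qed.

(** Chain rule: (a, b) and (c, d) are the likelihoods at two outputs. The entropy of x1 plus that of
    x2 given x1 is the joint entropy, which is also the sum of the entropies of the independent bits
    x1 + x2 and x2. *)
Lemma entropy2_chain a b c d : 0 <= a -> 0 <= b -> 0 <= c -> 0 <= d ->
  entropy2 (2^-1 * b * c + 2^-1 * a * d) (2^-1 * a * c + 2^-1 * b * d)
  + (entropy2 (2^-1 * a * c) (2^-1 * b * d) + entropy2 (2^-1 * b * c) (2^-1 * a * d))
  = 2^-1 * ((a + b) * entropy2 c d + (c + d) * entropy2 a b).
Proof.
move=> a0 b0 c0 d0; rewrite /entropy2 [2^-1 * a * c + 2^-1 * b * d as X in xlnx X]addrC.
have h2 : 0 <= 2^-1 :> R by rewrite invr_ge0.
have -> : 2^-1 * b * c + 2^-1 * a * d + (2^-1 * a * c + 2^-1 * b * d)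
  = 2^-1 * (a + b) * (c + d) by ring.
rewrite !xlnxM ?mulr_ge0 ?addr_ge0 //.
by rewrite xlnx_half; field.
Qed.

Section Combine.
Variables a b c d : R.
Hypotheses (a0 : 0 <= a) (b0 : 0 <= b) (c0 : 0 <= c) (d0 : 0 <= d).
Let x := `|(a - b) / (a + b)|.
Let y := `|(c - d) / (c + d)|.
Let e := entropy2 (2^-1 * b * c + 2^-1 * a * d) (2^-1 * a * c + 2^-1 * b * d).

(** Up to sign, the bias of an exclusive or of independent bits is the product of their biases. *)
Let eE : e = 2^-1 * (a + b) * (c + d) * (ln 2 - information (x * y) / 2).
Proof.
have h2 : 0 <= 2^-1 :> R by rewrite invr_ge0.
have n2 : 2^-1 != 0 :> R by rewrite invr_eq0 pnatr_eq0.
rewrite /e entropy2E ?addr_ge0 ?mulr_ge0 //.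
have -> : 2^-1 * b * c + 2^-1 * a * d - (2^-1 * a * c + 2^-1 * b * d)
  = 2^-1 * - ((a - b) * (c - d)) by field.
have -> : 2^-1 * b * c + 2^-1 * a * d + (2^-1 * a * c + 2^-1 * b * d)
  = 2^-1 * ((a + b) * (c + d)) by field.
rewrite -mulf_div divff // mul1r mulNr informationN -mulf_div.
by rewrite -information_norm normrM -/x -/y !mulrA.
Qed.

(** In terms of [information], the gap is a nonnegative multiple of 2 ln 2 I(xy) - I(x) I(y), where
    I(1) = 2 ln 2. *)
Lemma entropy2_combine_le :
  e + 2^-1 * (entropy2 a b * entropy2 c d / ln 2)
  <= 2^-1 * ((a + b) * entropy2 c d + (c + d) * entropy2 a b).
Proof.
have := information_mul (bias_le1 a0 b0) (bias_le1 c0 d0).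
rewrite information1 eE !entropy2E // -2!(information_norm (_ / _)) -/x -/y.
have := ln2_gt0; set L := ln 2 => L0.
set ix := information x; set iy := information y; set iz := information (x * y).
have : 0 <= (a + b) * (c + d) by rewrite mulr_ge0 ?addr_ge0.
set s := a + b; set t := c + d => st ineq.
rewrite -subr_ge0 [X in 0 <= X](_ : _ = (s * t) * (iz * (2 * L) - ix * iy) / (8 * L)).
  apply: divr_ge0; last by rewrite mulr_ge0 // ltW.
  by apply: mulr_ge0 => //; rewrite subr_ge0.
by field; rewrite gt_eqF.
Qed.

(** The product of the biases is at most y, and [information] is nondecreasing. *)
Lemma entropy2_combine_ge : 2^-1 * ((a + b) * entropy2 c d) <= e.
Proof.
rewrite eE entropy2E // -(information_norm (_ / _)) -/y -!mulrA.
rewrite !ler_wpM2l ?invr_ge0 ?addr_ge0 //.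
have /andP[x0 x1] := bias_le1 a0 b0; have /andP[y0 y1] := bias_le1 c0 d0.
have : information (x * y) <= information y.
  by rewrite information_le ?mulr_ge0 // ler_piMl.
lra.
Qed.

End Combine.

(** For a <= b, split into a ln((a + b)/a), bounded by [ln_le_inv_add], and b ln(1 + a/b), which is
    at most a and so at most a/t. *)
Lemma entropy2_le_min a b t : 0 <= a -> 0 <= b -> 0 < t <= 1 ->
  entropy2 a b <= 2 / t * Num.min a b + t * (a + b).
Proof.
wlog ab : a b / a <= b => [hw a0 b0 t01|a0 b0 /andP[t0 t1]].
  have [|/ltW] := leP a b => ab.
    by move: (hw a b ab a0 b0 t01); rewrite (min_idPl ab).
  move: (hw b a ab b0 a0 t01).
  by rewrite (min_idPl ab) entropy2C [b + a]addrC.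
rewrite (min_idPl ab); move: a0; rewrite le_eqVlt => /predU1P[<-|a0].
  by rewrite /entropy2 /xlnx !(add0r, mul0r, mulr0, subr0) subrr mulr_ge0 // ltW.
have b_gt0 : 0 < b by lra.
have s0 : 0 < a + b by lra.
have -> : entropy2 a b = a * ln ((a + b) / a) + b * ln (1 + a / b).
  rewrite (_ : 1 + a / b = (a + b) / b); last by field; rewrite gt_eqF.
  by rewrite !ln_div ?posrE // /entropy2 /xlnx; ring.
have h1 : b * ln (1 + a / b) <= a.
  rewrite -ler_pdivlMl // mulrC le_ln1Dx //.
  by apply: lt_le_trans (ltrN10 R) _; rewrite mulr_ge0 ?invr_ge0 // ltW.
have /(ler_wpM2l (ltW a0)) := ln_le_inv_add (divr_gt0 s0 a0) t0.
have -> : a * (t^-1 + t * ((a + b) / a)) = a / t + t * (a + b).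
  by field; rewrite !gt_eqF.
have : a <= a / t by rewrite ler_pdivlMr // ler_piMr // ltW.
rewrite [2 / t * a](_ : _ = a / t + a / t); last by field; rewrite gt_eqF.
lra.
Qed.

End BinaryEntropy.

(** * Entropy and error probability of a channel *)

Section Esum.
Local Open Scope classical_set_scope.
Variable R : realType.

Definition has_esum (T : choiceType) (f : T -> R) (a : R) : Prop :=
  (forall t, 0 <= f t) /\ (\esum_(t in [set: T]) (f t)%:E)%E = a%:E.

Lemma eq_has_esum (T : choiceType) (f g : T -> R) a b :
  has_esum f a -> (forall t, f t = g t) -> a = b -> has_esum g b.
Proof. by move=> fa fg <-; rewrite (_ : g = f) //; apply/funext. Qed.

Lemma has_esumD (T : choiceType) (f g : T -> R) a b :
  has_esum f a -> has_esum g b -> has_esum (fun t => f t + g t) (a + b).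
Proof.
move=> [f0 fa] [g0 gb]; split=> [t|]; first exact: addr_ge0.
under eq_esum do rewrite EFinD.
by rewrite esumD ?fa ?gb // => t _; rewrite lee_fin.
Qed.

Lemma has_esumZ (T : choiceType) (c : R) (f : T -> R) a : 0 <= c ->
  has_esum f a -> has_esum (fun t => c * f t) (c * a).
Proof.
move=> c0 [f0 fa]; split=> [t|]; first exact: mulr_ge0.
by rewrite esumZl // fa.
Qed.

Lemma le_has_esum (T : choiceType) (f g : T -> R) a b :
  has_esum f a -> has_esum g b -> (forall t, f t <= g t) -> a <= b.
Proof.
move=> [f0 fa] [g0 gb] fg; rewrite -lee_fin -fa -gb.
by apply: le_esum => t _; rewrite lee_fin.
Qed.

Lemma has_esum_unique (T : choiceType) (f g : T -> R) a b :
  has_esum f a -> has_esum g b -> (forall t, f t = g t) -> a = b.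
Proof.
move=> fa gb fg; apply/le_anti/andP; split;
  by [apply: le_has_esum fa gb _ => t; rewrite fg |
      apply: le_has_esum gb fa _ => t; rewrite fg].
Qed.

Lemma has_esum_reindex (T : choiceType) (s : T -> T) (f : T -> R) a :
  involutive s -> has_esum f a -> has_esum (fun t => f (s t)) a.
Proof.
move=> sK [f0 fa]; split=> //; rewrite -fa; symmetry.
apply: (@reindex_esum _ _ _ setT setT s (fun t => (f t)%:E)).
split=> //; first by move=> x y _ _; apply: (can_inj sK).
by move=> t _; exists (s t); rewrite ?sK.
Qed.

Lemma has_esumM (T U : choiceType) (f : T -> R) (g : U -> R) a b :
  has_esum f a -> has_esum g b ->
  has_esum (fun z : T * U => f z.1 * g z.2) (a * b).
Proof.
move=> [f0 fa] [g0 gb]; split=> [z|]; first exact: mulr_ge0.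
have -> : [set: T * U] = [set: T] `*`` (fun=> [set: U]).
  by apply/seteqP; split.
rewrite -(@esum_esum _ _ _ _ _ (fun t u => (f t * g u)%:E)); last first.
  by move=> t u _ _; rewrite lee_fin mulr_ge0.
have b0 : 0 <= b by rewrite -lee_fin -gb esum_ge0 // => u _; rewrite lee_fin.
have inner t : (\esum_(u in [set: U]) (f t * g u)%:E = (b * f t)%:E)%E.
  by rewrite esumZl // gb -EFinM mulrC.
under eq_esum do rewrite inner.
by rewrite esumZl // fa -EFinM mulrC.
Qed.

Lemma esum_pair_bool (T : choiceType) (f : T * bool -> R) : (forall z, 0 <= f z) ->
  (\esum_(z in [set: T * bool]) (f z)%:E =
   \esum_(t in [set: T]) (f (t, false) + f (t, true))%:E)%E.
Proof.
move=> f0; have -> : [set: T * bool] = [set: T] `*`` (fun=> [set: bool]).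
  by apply/seteqP; split.
rewrite (eq_esum (b := fun z => (f (z.1, z.2))%:E)); last by case.
rewrite -(@esum_esum _ _ _ _ _ (fun t u => (f (t, u))%:E)); last first.
  by move=> *; rewrite lee_fin.
apply: eq_esum => t _; rewrite esum_fset; last 2 first.
- exact: finite_finset.
- by move=> *; rewrite lee_fin.
rewrite (fsbigE [:: false; true]) //=; last by move=> [] _; rewrite !inE.
by rewrite !big_cons big_nil !in_setT adde0 EFinD.
Qed.

End Esum.

Section Channel.
Local Open Scope classical_set_scope.
Variables (R : realType) (W : bms R).
Let w1 := prob W true.
Let w0 := prob W false.

(** The involution of the output alphabet exchanges the two likelihoods. Adding a sum to its swapped
    copy turns the one-sided definitions of entropy and error into symmetric sums. *)
Lemma has_esum_swap (F : R -> R -> R) a :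
  has_esum (fun y => F (w1 y) (w0 y)) a -> has_esum (fun y => F (w0 y) (w1 y)) a.
Proof.
have [s sK sW] := prob_sym W.
move=> /(has_esum_reindex sK) h; apply: (eq_has_esum h) => // y.
by rewrite /w1 /w0 !sW sK.
Qed.

Lemma has_esum_mass : has_esum (fun y => w1 y + w0 y) 2.
Proof.
rewrite -[2](_ : 1 + 1 = _ :> R) //; apply: has_esumD; split=> [y|];
  by [exact: prob_ge0 | exact: prob_sum1].
Qed.

(** The factor 2 comes from the symmetrization, and ln 2 converts bits to nats. *)
Lemma has_esum_entropy :
  has_esum (fun y => entropy2 (w1 y) (w0 y)) (2 * ln 2 * entropy W).
Proof.
have l2 := ln2_gt0 R.
have h1 : has_esum (fun y : output W => ln 2 * entropy_term y) (ln 2 * entropy W).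
  apply: (has_esumZ (ltW l2)); split=> [y|]; first exact: entropy_term_ge0.
  by rewrite fineK ?entropy_fin_num.
have termE y : ln 2 * entropy_term y = w1 y * ln (w1 y + w0 y) - xlnx (w1 y).
  rewrite /entropy_term /log2 -/(w1 y) -/(w0 y) /xlnx.
  have := prob_ge0 W true y; rewrite -/(w1 y) le_eqVlt => /predU1P[<-|w_gt0].
    by rewrite !mul0r mulr0 subrr.
  have s_gt0 : 0 < w1 y + w0 y by rewrite ltr_wpDr ?prob_ge0.
  by rewrite ln_div ?posrE //; field; rewrite gt_eqF.
have h2 : has_esum (fun y => w1 y * ln (w1 y + w0 y) - xlnx (w1 y))
    (ln 2 * entropy W).
  exact: (eq_has_esum h1 termE).
have h3 := has_esum_swap (F := fun a b => a * ln (a + b) - xlnx a) h2.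
apply: (eq_has_esum (has_esumD h2 h3)) => [y|]; last by ring.
by rewrite /entropy2 [w0 y + w1 y]addrC /xlnx; ring.
Qed.

Lemma has_esum_error :
  has_esum (fun y => Num.min (w1 y) (w0 y)) (2 * error_prob W).
Proof.
have h1 : has_esum (@error_term R W) (error_prob W).
  by split=> [y|]; [exact: error_term_ge0 | rewrite fineK ?error_fin_num].
have h2 := has_esum_swap (F := fun a b =>
  a * ((a < b)%R%:R + 2^-1 * (b == a)%:R)) h1.
apply: (eq_has_esum (has_esumD h1 h2)) => [y|]; last by ring.
rewrite /error_term -/(w1 y) -/(w0 y).
by case: (ltgtP (w1 y) (w0 y)) => [||->];
  rewrite ?(mulr0, mulr1, addr0, add0r, mul0r) //; field.
Qed.

Lemma entropy_ge0 : 0 <= entropy W.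
Proof. by apply: fine_ge0; apply: esum_ge0 => y _; rewrite lee_fin entropy_term_ge0. Qed.

Lemma entropy_le1 : entropy W <= 1.
Proof.
have l2 := ln2_gt0 R.
have := le_has_esum has_esum_entropy (has_esumZ (ltW l2) has_esum_mass).
have h : forall y, entropy2 (w1 y) (w0 y) <= ln 2 * (w1 y + w0 y).
  by move=> y; rewrite mulrC entropy2_le ?prob_ge0.
by move=> /(_ h); nra.
Qed.

Lemma entropy_le_error t : 0 < t <= 1 ->
  ln 2 * entropy W <= 2 / t * error_prob W + t.
Proof.
move=> t01; have /andP[t0 _] := t01.
have t2 : 0 <= 2 / t by rewrite divr_ge0 // ltW.
have := le_has_esum has_esum_entropy (has_esumD
  (has_esumZ t2 has_esum_error) (has_esumZ (ltW t0) has_esum_mass)).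
have h y : entropy2 (w1 y) (w0 y) <=
    2 / t * Num.min (w1 y) (w0 y) + t * (w1 y + w0 y).
  by apply: entropy2_le_min; rewrite ?prob_ge0.
by move=> /(_ h); lra.
Qed.

Let s (y : output W) := w1 y + w0 y.
Let e (y : output W) := entropy2 (w1 y) (w0 y).

Lemma has_esum_cross : has_esum
  (fun y : output W * output W => 2^-1 * (s y.1 * e y.2 + s y.2 * e y.1))
  (4 * ln 2 * entropy W).
Proof.
have h1 := has_esumM has_esum_mass has_esum_entropy.
have h2 := has_esumM has_esum_entropy has_esum_mass.
have half0 : 0 <= 2^-1 :> R by rewrite invr_ge0.
apply: (eq_has_esum (has_esumZ half0 (has_esumD h1 h2))) => [y|]; last by field.
by rewrite [s y.2 * _]mulrC.
Qed.

End Channel.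

Section Polarization.
Local Open Scope classical_set_scope.
Variables (R : realType) (W : bms R).
Let w1 := prob W true.
Let w0 := prob W false.
Let s y := w1 y + w0 y.
Let e y := entropy2 (w1 y) (w0 y).

Lemma has_esum_entropy_minus : has_esum (fun y : output W * output W =>
    entropy2 (2^-1 * w0 y.1 * w1 y.2 + 2^-1 * w1 y.1 * w0 y.2)
             (2^-1 * w1 y.1 * w1 y.2 + 2^-1 * w0 y.1 * w0 y.2))
  (2 * ln 2 * entropy (transform W false)).
Proof.
apply: (eq_has_esum (has_esum_entropy (transform W false))) => // y.
by rewrite /= /prob0 !big_bool.
Qed.

Lemma has_esum_entropy_plus : has_esum (fun y : output W * output W =>
    entropy2 (2^-1 * w1 y.1 * w1 y.2) (2^-1 * w0 y.1 * w0 y.2)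
    + entropy2 (2^-1 * w0 y.1 * w1 y.2) (2^-1 * w1 y.1 * w0 y.2))
  (2 * ln 2 * entropy (transform W true)).
Proof.
have [F0 F] := has_esum_entropy (transform W true).
split=> [y|]; first by rewrite addr_ge0 ?entropy2_ge0 ?mulr_ge0 ?prob_ge0 ?invr_ge0.
by rewrite -F esum_pair_bool.
Qed.

Lemma entropy_transform_add :
  entropy (transform W false) + entropy (transform W true) = 2 * entropy W.
Proof.
have l2 := ln2_gt0 R.
have := has_esum_unique (has_esumD has_esum_entropy_minus has_esum_entropy_plus)
  (has_esum_cross W).
have h y : entropy2 (2^-1 * w0 y.1 * w1 y.2 + 2^-1 * w1 y.1 * w0 y.2)
    (2^-1 * w1 y.1 * w1 y.2 + 2^-1 * w0 y.1 * w0 y.2)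
  + (entropy2 (2^-1 * w1 y.1 * w1 y.2) (2^-1 * w0 y.1 * w0 y.2)
     + entropy2 (2^-1 * w0 y.1 * w1 y.2) (2^-1 * w1 y.1 * w0 y.2))
  = 2^-1 * (s y.1 * e y.2 + s y.2 * e y.1).
  by rewrite entropy2_chain ?prob_ge0.
move=> /(_ h) eq; apply: (mulfI (_ : 2 * ln 2 != 0)).
  by rewrite mulf_neq0 // gt_eqF.
by rewrite mulrDr eq; ring.
Qed.

(** Summed over pairs of outputs, the product term of [entropy2_combine_le] factors and becomes the
    square of the entropy. *)
Lemma entropy_transform0_le :
  entropy (transform W false) <= 2 * entropy W - entropy W ^+ 2.
Proof.
have l2 := ln2_gt0 R.
have c0 : 0 <= (2 * ln 2)^-1 :> R by rewrite invr_ge0 mulr_ge0 // ltW.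
have := le_has_esum (has_esumD has_esum_entropy_minus (has_esumZ c0
  (has_esumM (has_esum_entropy W) (has_esum_entropy W)))) (has_esum_cross W).
have h y : entropy2 (2^-1 * w0 y.1 * w1 y.2 + 2^-1 * w1 y.1 * w0 y.2)
    (2^-1 * w1 y.1 * w1 y.2 + 2^-1 * w0 y.1 * w0 y.2)
  + (2 * ln 2)^-1 * (e y.1 * e y.2) <= 2^-1 * (s y.1 * e y.2 + s y.2 * e y.1).
  apply: le_trans (entropy2_combine_le _ _ _ _); rewrite ?prob_ge0 //.
  rewrite lerD2l le_eqVlt; apply/orP; left; apply/eqP.
  by rewrite -/(e y.1) -/(e y.2); field; rewrite gt_eqF.
move=> /(_ h); rewrite (_ : (2 * ln 2)^-1 * _ = 2 * ln 2 * entropy W ^+ 2).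
  by move=> h'; rewrite -(ler_pM2l (mulr_gt0 (ltr0Sn R 1) l2)); lra.
by field; rewrite gt_eqF.
Qed.

Lemma entropy_transform0_ge : entropy W <= entropy (transform W false).
Proof.
have l2 := ln2_gt0 R.
have half0 : 0 <= 2^-1 :> R by rewrite invr_ge0.
have := le_has_esum (has_esumZ half0
  (has_esumM (has_esum_mass W) (has_esum_entropy W))) has_esum_entropy_minus.
have h y : 2^-1 * (s y.1 * e y.2) <=
    entropy2 (2^-1 * w0 y.1 * w1 y.2 + 2^-1 * w1 y.1 * w0 y.2)
    (2^-1 * w1 y.1 * w1 y.2 + 2^-1 * w0 y.1 * w0 y.2).
  by apply: entropy2_combine_ge; rewrite prob_ge0.
by move=> /(_ h) h'; rewrite -(ler_pM2l (mulr_gt0 (ltr0Sn R 1) l2)); lra.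
Qed.

End Polarization.

(** * The polarization tree *)

Section Tree.
Variables (R : realType) (W : bms R).

Lemma bitsS n i : bits n.+1 i = rcons (bits n (i %/ 2)) (odd i).
Proof.
have iotaSr : iota 1 n.+1 = iota 1 n ++ [:: n.+1].
  by rewrite -[in LHS](addn1 n) iotaD add1n.
rewrite /bits iotaSr map_cat /= cats1 subnn expn0 divn1.
congr rcons; apply/eq_in_map => j; rewrite mem_iota add1n ltnS => /andP[_ jn].
by rewrite subSn // expnS divnMA.
Qed.

Lemma subchannelS n i :
  subchannel W n.+1 i = transform (subchannel W n (i %/ 2)) (odd i).
Proof. by rewrite /subchannel bitsS foldl_rcons. Qed.

Lemma big_ord_double (F : nat -> R) m :
  \sum_(i < m.*2) F i = \sum_(i < m) (F i.*2 + F i.*2.+1).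
Proof.
elim: m => [|m IH]; first by rewrite !big_ord0.
by rewrite doubleS !big_ord_recr /= IH addrA.
Qed.

Lemma sum_subchannelS (F : bms R -> R) n :
  \sum_(i < 2 ^ n.+1) F (subchannel W n.+1 i) =
  \sum_(i < 2 ^ n) (F (transform (subchannel W n i) false)
                    + F (transform (subchannel W n i) true)).
Proof.
rewrite expnS mul2n (big_ord_double (fun i => F (subchannel W n.+1 i))).
apply: eq_bigr => i _; rewrite !subchannelS /= odd_double !divn2 doubleK.
by rewrite (half_bit_double i true).
Qed.

Lemma sum_entropy n :
  \sum_(i < 2 ^ n) entropy (subchannel W n i) = 2 ^+ n * entropy W.
Proof.
elim: n => [|n IH]; first by rewrite big_ord1 expr0 mul1r.
rewrite (sum_subchannelS (@entropy R)) exprS -mulrA -IH mulr_sumr.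
by apply: eq_bigr => i _; rewrite entropy_transform_add.
Qed.

(** The two new entropies have the same sum as h^2 and 2h - h^2 and lie between them, so concavity
    gives them at least the same total of g. The factor 211/128 is twice 211/256, as the number of
    channels doubles. *)
Lemma sum_concave_ge (g : R -> R) n :
  (forall x y t, 0 <= t <= 1 ->
     (1 - t) * g x + t * g y <= g ((1 - t) * x + t * y)) ->
  (forall x, 0 <= x <= 1 ->
     211 * g x <= 128 * (g (x ^+ 2) + g (2 * x - x ^+ 2))) ->
  (211 / 128) ^+ n * g (entropy W)
  <= \sum_(i < 2 ^ n) g (entropy (subchannel W n i)).
Proof.
move=> concave gain.
have step (V : bms R) : 211 / 128 * g (entropy V) <=
    g (entropy (transform V false)) + g (entropy (transform V true)).
  have h0 := entropy_ge0 V; have h1 := entropy_le1 V.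
  have := entropy_transform_add V; have := entropy_transform0_le V.
  have := entropy_transform0_ge V.
  have := gain (entropy V); rewrite h0 h1 => /(_ isT).
  set h := entropy V in h0 h1 *; set a := entropy _; set b := entropy _.
  move=> gh ha ah ab.
  have bE : b = 2 * h - a by lra.
  (* For h = 0 or 1 the interval from h^2 to 2h - h^2 is a point, and the weight t below would have
     denominator 0. *)
  have [d0|d0] := eqVneq (h - h ^+ 2) 0.
    have hh : h ^+ 2 = h by lra.
    move: gh; rewrite hh (_ : 2 * h - h = h); last by ring.
    have aE : a = h by apply/le_anti; rewrite ha andbT; lra.
    have -> : b = h by lra.
    by rewrite aE; lra.
  have d_gt0 : 0 < h - h ^+ 2 by rewrite lt_neqAle eq_sym d0 /=; nra.
  pose t := (a - h ^+ 2) / (2 * (h - h ^+ 2)).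
  have t01 : 0 <= t <= 1.
    rewrite /t divr_ge0 /=; [|lra|lra].
    by rewrite ler_pdivrMr; lra.
  have := concave (h ^+ 2) (2 * h - h ^+ 2) t t01.
  have -> : (1 - t) * h ^+ 2 + t * (2 * h - h ^+ 2) = a by rewrite /t; field.
  have t01' : 0 <= 1 - t <= 1 by lra.
  have := concave (h ^+ 2) (2 * h - h ^+ 2) (1 - t) t01'.
  have -> : (1 - (1 - t)) * h ^+ 2 + (1 - t) * (2 * h - h ^+ 2) = b.
    by rewrite bE /t; field.
  lra.
elim: n => [|n IH]; first by rewrite expr0 mul1r big_ord1.
rewrite (sum_subchannelS (fun V => g (entropy V))) exprS -mulrA.
apply: (@le_trans _ _ (\sum_(i < 2 ^ n) 211 / 128 * g (entropy (subchannel W n i)))).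
  by rewrite -mulr_sumr; apply: ler_wpM2l => //; lra.
by apply: ler_sum => i _; exact: step.
Qed.

End Tree.

(** * Powers of the block length and the loss of rate *)

Lemma powR_natX (R : realType) (x : nat) (m : R) n :
  (x ^ n)%:R `^ m = (x%:R `^ m) ^+ n.
Proof.
elim: n => [|n IH]; first by rewrite expn0 expr0 powR1.
by rewrite expnS natrM powRM // IH exprS.
Qed.

Lemma rate_le (R : realType) (n : nat) :
  (2 ^ n)%:R / (2 ^ n)%:R `^ (1 / (3579%:R / 1000%:R)) <= (211 / 128) ^+ n :> R.
Proof.
set m := 1 / _.
(* The exponent 12/43 lies just below 1000/3579, as 12 · 3579 = 42948 < 43000. *)
have base : 256 / 211 <= 2 `^ m :> R.
  have x0 : 0 <= 256 / 211 :> R by lra.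
  apply: (@le_trans _ _ (2 `^ (12 * 43^-1))); last first.
    by apply: ler_powR; [lra | rewrite /m; lra].
  rewrite powRrM -{1}(powRr1 x0) -[X in _ `^ X <= _](@divff _ 43); last by lra.
  rewrite powRrM; apply: ge0_ler_powR; rewrite ?nnegrE ?powR_ge0 ?invr_ge0 //.
  rewrite !powR_mulrn // expr_div_n ler_pdivrMr ?exprn_gt0 //.
  apply: le_trans (ler_wpM2l _ (pow_211_43 R)); last by rewrite exprn_ge0.
  by rewrite -exprD -[256]/((2 ^ 8)%:R) natrX -exprM.
rewrite powR_natX natrX -expr_div_n; apply: lerXn2r; rewrite ?nnegrE ?divr_ge0 ?powR_ge0 //.
rewrite ler_pdivrMr ?powR_gt0 //; lra.
Qed.

(** Since 1/mu <= 1/2, the contribution of the good indices, of order sqrt N, can be absorbed into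
    the main term. *)
Lemma sqrt_le_rate (R : realType) (n : nat) :
  Num.sqrt (2 ^ n)%:R <= (2 ^ n)%:R / (2 ^ n)%:R `^ (1 / (3579%:R / 1000%:R)) :> R.
Proof.
set N : R := (2 ^ n)%:R; set m := 1 / _.
have N1 : 1 <= N by rewrite ler1n expn_gt0.
have N0 : 0 < N by lra.
have NE : N = Num.sqrt N * Num.sqrt N by rewrite -expr2 sqr_sqrtr ?ltW.
rewrite ler_pdivlMr ?powR_gt0 // [leRHS]NE ler_pM2l ?sqrtr_gt0 // -(powR12_sqrt (ltW N0)).
by apply: ler_powR => //; rewrite /m; lra.
Qed.

Theorem theorem16 (R : realType) (c : R) (hc : 0 < c < 1) :
  let mu : R := 3579%:R / 1000%:R in
  exists Pe alpha : R, [/\ 0 < Pe, 0 < alpha &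
    forall W : bms R, capacity W = c ->
    forall (n : nat) (r : R),
      (exists2 k : nat, (k <= 2 ^ n)%N & (2 ^ n)%:R * r = k%:R) ->
    forall G : {set 'I_(2 ^ n)}, good_indices W r G ->
      \sum_(i in G) error_prob (subchannel W n i) <= Pe ->
      r < capacity W - alpha / (2 ^ n)%:R `^ (1 / mu)].
Proof.
move=> mu; have [g [K [K0 g_gt0 g_le concave gain]]] := contraction_function R.
have /andP[c0 c1] := hc.
have l2 := ln2_gt0 R.
have gc0 : 0 < g (1 - c) by apply: g_gt0; lra.
(* Here 24 = 3 · 8: the good indices contribute at most 3 eps sqrt N nats of entropy, to be kept
   below one eighth of the main term. *)
pose eps : R := Num.min 1 (g (1 - c) * ln 2 / (24 * K)).
have eps0 : 0 < eps by rewrite lt_min ltr01 divr_gt0 ?mulr_gt0.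
have eps1 : eps <= 1 by rewrite ge_min lexx.
have epsE : eps <= g (1 - c) * ln 2 / (24 * K) by rewrite ge_min lexx orbT.
exists (eps ^+ 2), (g (1 - c) / (2 * K)); split.
- exact: exprn_gt0.
- by rewrite divr_gt0 ?mulr_gt0.
move=> W Wc n r _ G [cardG _] sumE.
have HW : entropy W = 1 - c by rewrite -Wc /capacity; ring.
have hrate := rate_le R n; have hsqrt := sqrt_le_rate R n.
have hgain := sum_concave_ge W n concave gain.
have hsum := sum_entropy W n.
rewrite Wc -/mu in hrate hsqrt *.
set N : R := (2 ^ n)%:R in cardG hrate hsqrt *.
set q := N `^ (1 / mu) in hrate hsqrt *.
have NN : (2 ^ n)%:R = N by [].
have N1 : 1 <= N by rewrite ler1n expn_gt0.
have N0 : 0 < N := lt_le_trans ltr01 N1.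
have q0 : 0 < q by rewrite powR_gt0.
have sN0 : 0 < Num.sqrt N by rewrite sqrtr_gt0.
have sN1 : 1 <= Num.sqrt N by rewrite -[leLHS]sqrtr1 ler_sqrt // ltW.
have NE : N = Num.sqrt N * Num.sqrt N by rewrite -expr2 sqr_sqrtr ?ltW.
have GN : #|G|%:R <= N.
  by rewrite ler_nat (leq_trans (max_card _)) // card_ord.
clearbody q N.
pose H (i : 'I_(2 ^ n)) := entropy (subchannel W n i).
pose S := \sum_(i in G) H i.
have S_le : ln 2 * S <= 3 * eps * Num.sqrt N.
  (* This choice balances the terms: eps^2/t and t N are both eps sqrt N. *)
  pose t := eps / Num.sqrt N.
  have t0 : 0 < t by rewrite divr_gt0.
  have t1 : t <= 1 by rewrite ler_pdivrMr // mul1r (le_trans eps1).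
  have t01 : 0 < t <= 1 by rewrite t0.
  have : ln 2 * S <=
      2 / t * (\sum_(i in G) error_prob (subchannel W n i)) + t * #|G|%:R.
    rewrite !mulr_sumr [t * _](_ : _ = \sum_(i in G) t); last first.
      by rewrite sumr_const mulr_natr.
    rewrite -big_split /=; apply: ler_sum => i _; exact: entropy_le_error.
  move=> /le_trans; apply.
  have h1 : 2 / t * (\sum_(i in G) error_prob (subchannel W n i))
      <= 2 * eps * Num.sqrt N.
    apply: (@le_trans _ _ (2 / t * eps ^+ 2)).
      by rewrite ler_wpM2l // divr_ge0 // ltW.
    by rewrite le_eqVlt; apply/orP; left; apply/eqP; rewrite /t; field; rewrite !gt_eqF.
  have h2 : t * #|G|%:R <= eps * Num.sqrt N.
    apply: (@le_trans _ _ (t * N)); first by rewrite ler_pM2l.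
    by rewrite {1}NE mulrA divfK ?gt_eqF.
  by apply: le_trans (lerD h1 h2) _; rewrite le_eqVlt; apply/orP; left; apply/eqP; ring.
have sum_g : \sum_(i < 2 ^ n) g (H i) <= K * (N * c - N * r + 2 * S).
  (* One formula for both cases: the right side is K H_i on G and K (1 - H_i) off G. *)
  have gH i : g (H i) <= K * (1 - H i - (i \in G)%:R + 2 * ((i \in G)%:R * H i)).
    have [g1 g2] := g_le (H i).
    case: (i \in G) => /=.
      by rewrite mul1r (_ : 1 - _ - _ + _ = H i) //; ring.
    by rewrite mul0r mulr0 addr0 subr0.
  apply: le_trans (ler_sum _ (fun i _ => gH i)) _.
  rewrite -mulr_sumr ler_pM2l // big_split /= -mulr_sumr !sumrB.
  have -> : \sum_(i < 2 ^ n) (i \in G)%:R * H i = S.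
    rewrite /S [RHS]big_mkcond; apply: eq_bigr => i _.
    by case: (i \in G); rewrite (mul1r, mul0r).
  have -> : \sum_(i < 2 ^ n) (i \in G)%:R = N * r :> R.
    rewrite -cardG -sum1_card natr_sum [RHS]big_mkcond; apply: eq_bigr => i _.
    by case: (i \in G).
  rewrite /H hsum HW sumr_const card_ord -natrX NN.
  by rewrite (_ : N - N * (1 - c) = N * c) //; ring.
have key : N / q * g (1 - c) <= K * (N * c - N * r + 2 * S).
  apply: le_trans sum_g; apply: le_trans hgain; rewrite HW.
  by rewrite ler_pM2r.
pose gK := g (1 - c) / K.
have gK0 : 0 < gK by rewrite divr_gt0.
have {}key : N / q * gK <= N * c - N * r + 2 * S.
  by rewrite /gK mulrA ler_pdivrMr // [leRHS]mulrC.
have {}S_le : S <= N / q * (gK / 8).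
  rewrite -(ler_pM2l l2); apply: le_trans S_le _.
  apply: (@le_trans _ _ (3 * eps * (N / q))).
    by rewrite ler_pM2l // mulr_gt0.
  rewrite [leRHS]mulrCA [leLHS]mulrC ler_pM2l ?divr_gt0 //.
  have -> : ln 2 * (gK / 8) = 3 * (g (1 - c) * ln 2 / (24 * K)).
    by rewrite /gK; field; rewrite gt_eqF.
  by rewrite ler_pM2l.
have -> : g (1 - c) / (2 * K) / q = gK / 2 / q.
  by rewrite /gK; field; rewrite !gt_eqF.
(* Subtracting 2S leaves at least 3/4 of the main term, so the constant 1/2 in alpha makes the
   inequality strict. *)
have : N * (gK / 2 / q) < N * (c - r).
  have -> : N * (gK / 2 / q) = N / q * gK / 2 by field; rewrite gt_eqF.
  have : 0 < N / q * gK by rewrite mulr_gt0 ?divr_gt0.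
  by rewrite mulrA in S_le; clear -key S_le; lra.
rewrite ltr_pM2l // => lt_cr; clear -lt_cr; lra.
Qed.
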